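(* If $|\Sigma|=2$, then $V_{\mathcal{H}_d,n}=V_{\mathcal{M}_d,n}$.
   Context: $\Sigma$ is a finite alphabet, and $d,n\ge 1$ are integers. Transposition is written $'$, and $\mathbf{1}=(1,\dots,1)'\in\mathbb{C}^d$. For matrices $(T_a)_{a\in\Sigma}$ and $v=a_1\cdots a_n\in\Sigma^n$ write $T_v=T_{a_1}\cdots T_{a_n}$. Finitary model: $\mathcal{M}_d=\{((T_a)_{a\in\Sigma},\pi)\in(\mathbb{C}^{d\times d})^{\Sigma}\times\mathbb{C}^d \mid \sum_{a}T_a\mathbf{1}=\mathbf{1}\}$ and $\mathbf{f}_{\mathcal{M}_d,n}:\mathcal{M}_d\to\mathbb{C}^{\Sigma^n}$, $((T_a),\pi)\mapsto(\pi'T_v\mathbf{1})_{v\in\Sigma^n}$. Hidden Markov model: $\mathcal{H}_d=\{(M,E,\pi)\in\mathbb{C}^{d\times d}\times\mathbb{C}^{d\times\Sigma}\times\mathbb{C}^d \mid \sum_j m_{ij}=1,\ \sum_{a}e_{ia}=1\text{ for all }i\}$ and $\mathbf{f}_{\mathcal{H}_d,n}:\mathcal{H}_d\to\mathbb{C}^{\Sigma^n}$, $(M,E,\pi)\mapsto(\pi'T_v\mathbf{1})_{v\in\Sigma^n}$ with $T_a=O_aM$, $O_a=\mathrm{diag}(e_{1a},\dots,e_{da})$. $V_{\mathcal{M}_d,n}$ and $V_{\mathcal{H}_d,n}$ are the closures in $\mathbb{C}^{\Sigma^n}$ of the images of $\mathbf{f}_{\mathcal{M}_d,n}$ and $\mathbf{f}_{\mathcal{H}_d,n}$,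 respectively (the topological and Zariski closures coincide). *)

(* Defs.v *)
From HB Require Import structures.
From mathcomp Require Import all_boot all_order all_algebra.
From mathcomp Require Import complex.
From mathcomp Require Import all_classical all_reals all_analysis.

Set Implicit Arguments.
Unset Strict Implicit.
Unset Printing Implicit Defensive.

Import Order.TTheory GRing.Theory Num.Theory.

Local Open Scope classical_set_scope.
Local Open Scope ring_scope.
Local Open Scope complex_scope.

(* C^(Sigma^n). The regular-module alias R[i]^o carries the topology of the
   complex modulus, and ptws puts the product topology on the coordinates; as
   Sigma^n is finite, this is the Euclidean topology. *)
Definition word_space (R : realType) (Sigma : finType) (n : nat) :=
  {ptws n.-tuple Sigma -> R[i]^o}.

Definition ones (R : realType) (d : nat) : 'cV[R[i]]_d := const_mx 1.

Definition word_mx (R : realType) (Sigma : finType) (d : nat)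
    (T : Sigma -> 'M[R[i]]_d) (v : seq Sigma) : 'M[R[i]]_d :=
  \big[mulmx/1%:M]_(a <- v) T a.

Definition word_fun (R : realType) (Sigma : finType) (d n : nat)
    (T : Sigma -> 'M[R[i]]_d) (pi : 'cV[R[i]]_d) : word_space R Sigma n :=
  fun v => (pi^T *m word_mx T v *m ones R d) 0 0.

(* Pairs ((T_a)_a, pi). *)
Definition finitary_param (R : realType) (Sigma : finType) (d : nat) : Type :=
  ((Sigma -> 'M[R[i]]_d) * 'cV[R[i]]_d)%type.

Definition finitary_model (R : realType) (Sigma : finType) (d : nat) :
    set (finitary_param R Sigma d) :=
  [set p : finitary_param R Sigma d |
     (\sum_(a : Sigma) p.1 a) *m ones R d = ones R d].

Definition finitary_map (R : realType) (Sigma : finType) (d n : nat)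
    (p : finitary_param R Sigma d) : word_space R Sigma n :=
  word_fun p.1 p.2.

(* Triples (M, E, pi), where E i a is the entry e_{ia} of the d x Sigma emission
   matrix. *)
Definition hidden_markov_param (R : realType) (Sigma : finType) (d : nat) :
    Type :=
  ('M[R[i]]_d * ('I_d -> Sigma -> R[i]) * 'cV[R[i]]_d)%type.

Definition hidden_markov_model (R : realType) (Sigma : finType) (d : nat) :
    set (hidden_markov_param R Sigma d) :=
  [set p : hidden_markov_param R Sigma d | forall i : 'I_d,
     \sum_(j < d) p.1.1 i j = 1 /\ \sum_(a : Sigma) p.1.2 i a = 1].

Definition emission_mx (R : realType) (Sigma : finType) (d : nat)
    (E : 'I_d -> Sigma -> R[i]) (a : Sigma) : 'M[R[i]]_d :=
  diag_mx (\row_(i < d) E i a).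

Definition hidden_markov_map (R : realType) (Sigma : finType) (d n : nat)
    (p : hidden_markov_param R Sigma d) : word_space R Sigma n :=
  word_fun (fun a => emission_mx p.1.2 a *m p.1.1) p.2.

Arguments finitary_model R Sigma d : clear implicits.
Arguments hidden_markov_model R Sigma d : clear implicits.
Arguments finitary_map {R Sigma d} n p.
Arguments hidden_markov_map {R Sigma d} n p.

(* The image of a polynomial map is constructible, so this topological closure
   is also its Zariski closure. *)
Definition V_finitary (R : realType) (Sigma : finType) (d n : nat) :
    set (word_space R Sigma n) :=
  closure (finitary_map n @` finitary_model R Sigma d).

Definition V_hidden_markov (R : realType) (Sigma : finType) (d n : nat) :
    set (word_space R Sigma n) :=
  closure (hidden_markov_map n @` hidden_markov_model R Sigma d).

Arguments V_finitary R Sigma d n : clear implicits.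
Arguments V_hidden_markov R Sigma d n : clear implicits.

(* Main.v *)
(** Write [M] for the sum of the two matrices of a finitary parameter. When
[M] is invertible and [A = T_a0 M^-1] is diagonalizable, a basis of
eigenvectors of [A] makes both [T_a0 M^-1 = A] and [T_a1 M^-1 = 1 - A]
diagonal; if moreover the vector [1] has nonzero coordinates in that basis,
rescaling the eigenvectors turns it back into [1], and the parameter has become
a hidden Markov parameter with the same word function. Each of the three
genericity conditions is reached by an affine perturbation that stays in the
model, along which the word function is polynomial; so word functions of
arbitrary parameters are limits of hidden Markov ones. *)
Require Import Defs.
From mathcomp Require Import all_boot all_order all_algebra.
From mathcomp Require Import complex.
From mathcomp Require Import all_classical all_reals all_analysis.

Set Implicit Arguments.
Unset Strict Implicit.
Unset Printing Implicit Defensive.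

Import Order.TTheory GRing.Theory Num.Theory numFieldNormedType.Exports.

Local Open Scope classical_set_scope.
Local Open Scope ring_scope.
Local Open Scope complex_scope.

(** * Continuity and isolated zeros of polynomials *)

Lemma continuous_horner_num (K : numFieldType) (p : {poly K}) :
  continuous (fun t : K^o => p.[t] : K^o).
Proof.
elim/poly_ind: p => [|p c IHp] x.
  have -> : (fun t => (0 : {poly K}).[t]) = cst 0.
    by apply/funext => t; rewrite horner0.
  exact: cst_continuous.
have -> : (fun t => (p * 'X + c%:P).[t]) = (fun t => p.[t] * t + c).
  by apply/funext => t; rewrite hornerMXaddC.
apply: (@continuousD K K^o K^o (fun t => p.[t] * t) (cst c)); last first.
  exact: cst_continuous.
apply: (@continuousM K K^o (fun t => p.[t]) id); last exact: cvg_id.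
exact: IHp.
Qed.

(** Factor out the full power of ['X - x]: the cofactor is nonzero at [x], hence near [x] by
    continuity. *)
Lemma near_dnbhs_horner_neq0 (K : numFieldType) (p : {poly K}) (x : K^o) :
  p != 0 -> \forall t \near x^', p.[t] != 0.
Proof.
move=> p_neq0; have [m [q]] := multiplicity_XsubC p x.
rewrite p_neq0 /= => qx0 ->.
have q_neq0 : \forall t \near x^', q.[t] != 0.
  apply: nbhs_dnbhs.
  exact: (@cvgr_neq0 K K^o _ _ _ (horner q) _
    (continuous_horner_num (x := x)) qx0).
near=> t.
rewrite hornerM horner_exp hornerXsubC mulf_neq0 ?expf_neq0 ?subr_eq0 //.
  by near: t.
by near: t; exact: nbhs_dnbhs_neq.
Unshelve. all: by end_near. Qed.

(** * Word values under change of basis and ring morphisms *)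

Section WordValue.
Variables (K : comNzRingType) (Sigma : finType) (d : nat).
Implicit Types (T : Sigma -> 'M[K]_d) (p : 'rV[K]_d) (w : 'cV[K]_d).

(** The ring is arbitrary so that polynomial matrices are allowed, and [w] replaces the vector of
    ones because changes of basis move it. *)
Definition word_value p T w (v : seq Sigma) : K :=
  (p *m (\big[mulmx/1%:M]_(a <- v) T a) *m w) 0 0.

Lemma word_value_intertwine (S : 'M[K]_d) T T' p w w' v :
  (forall a, T a *m S = S *m T' a) -> S *m w' = w ->
  word_value p T w v = word_value (p *m S) T' w' v.
Proof.
move=> TS <-; rewrite /word_value.
suff TvS : (\big[mulmx/1%:M]_(a <- v) T a) *m S =
           S *m (\big[mulmx/1%:M]_(a <- v) T' a).
  by rewrite mulmxA -[p *m _ *m S]mulmxA TvS !mulmxA.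
elim: v => [|a v IHv]; first by rewrite !big_nil mulmx1 mul1mx.
by rewrite !big_cons -mulmxA IHv !mulmxA TS.
Qed.

Lemma eq_word_value T T' p w v :
  T =1 T' -> word_value p T w v = word_value p T' w v.
Proof. by move=> eqT; rewrite /word_value (eq_bigr T'). Qed.

End WordValue.

Lemma map_word_value (K L : comNzRingType) (f : {rmorphism K -> L})
    (Sigma : finType) d (T : Sigma -> 'M[K]_d) p w v :
  f (word_value p T w v) =
  word_value (map_mx f p) (fun a => map_mx f (T a)) (map_mx f w) v.
Proof.
have f00 (X : 'M[K]_1) : f (X 0 0) = map_mx f X 0 0 by rewrite mxE.
rewrite /word_value f00 !map_mxM; congr ((_ *m _ *m _) 0 0).
by elim: v => [|a v IHv]; rewrite ?big_nil ?map_mx1 // !big_cons map_mxM IHv.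
Qed.

Definition affine_mx (K : comNzRingType) m n (A B : 'M[K]_(m, n)) :
    'M[{poly K}]_(m, n) :=
  map_mx polyC A + 'X *: map_mx polyC B.

Lemma horner_affine_mx (K : comNzRingType) m n (A B : 'M[K]_(m, n)) t :
  map_mx (horner_eval t) (affine_mx A B) = A + t *: B.
Proof.
by apply/matrixP => i j; rewrite !mxE /horner_eval !hornerE.
Qed.

(** * Limits along polynomial curves *)

Section Closure.
Variables (R : realType) (Sigma : finType) (d n : nat).
Local Notation C := R[i].

(** Since [q] has no zero in a punctured neighbourhood of 0, the curve lies in [X] for small
    [t != 0], and it is continuous at 0. *)
Lemma closure_poly_curve (X : set (word_space R Sigma n))
    (F : n.-tuple Sigma -> {poly C}) (q : {poly C}) :
  q != 0 ->
  (forall t, q.[t] != 0 -> X (fun v => (F v).[t])) ->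
  closure X (fun v => (F v).[0]).
Proof.
move=> q_neq0 XF B nbB.
pose G (t : C^o) : word_space R Sigma n := fun v => (F v).[t].
have cvgG : G t @[t --> (0 : C^o)^'] --> G 0.
  (* Pointwise convergence is checked one coordinate at a time; constant functions show that
     evaluation at [v] is surjective. *)
  apply/cvg_sup => v; apply/cvg_image.
    by rewrite eqEsubset; split=> c // _; exists (fun=> c).
  move=> W nbW.
  have Fv : (F v).[t] @[t --> (0 : C^o)^'] --> ((F v).[0] : C^o).
    by move=> A /(@continuous_horner_num _ (F v) 0); exact: nbhs_dnbhs.
  exists (@^~ v @^-1` W); last first.
    by rewrite eqEsubset; split => [c [? + <-//]|c Wc]; exists (fun _ => c).
  exact: Fv.
have q_near := near_dnbhs_horner_neq0 (0 : C^o) q_neq0.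
have [t [qt Bt]] := filter_ex (filterI q_near (cvgG _ nbB)).
by exists (G t); split => //; exact: XF.
Qed.

(** The word value of the affine matrices over the polynomial ring gives the curve: evaluation at
    [t] is a ring morphism, so it commutes with [word_value]. *)
Lemma closure_affine (X : set (word_space R Sigma n)) (p : 'rV[C]_d)
    (T T' : Sigma -> 'M[C]_d) (w w' : 'cV[C]_d) (q : {poly C}) :
  q != 0 ->
  (forall t, q.[t] != 0 ->
     X (word_value p (fun a => T a + t *: T' a) (w + t *: w'))) ->
  closure X (word_value p T w).
Proof.
move=> q_neq0 XT.
pose F (v : n.-tuple Sigma) :=
  word_value (map_mx polyC p) (fun a => affine_mx (T a) (T' a))
    (affine_mx w w') v.
have F_t t v : (F v).[t] =
    word_value p (fun a => T a + t *: T' a) (w + t *: w') v.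
  rewrite -/(horner_eval t (F v)) map_word_value horner_affine_mx.
  rewrite -map_mx_comp map_mx_id; last first.
    by move=> x; rewrite /= /horner_eval hornerC.
  by apply: eq_word_value => a; rewrite horner_affine_mx.
suff -> : word_value p T w = (fun v => (F v).[0]) :> word_space R Sigma n.
  apply: (closure_poly_curve q_neq0) => t /XT.
  by congr X; apply/funext => v; rewrite F_t.
apply/funext => v; rewrite F_t scale0r addr0.
by apply: eq_word_value => a; rewrite scale0r addr0.
Qed.

(** As the target is closed, successive perturbations can be chained. *)
Lemma closure_affine_hidden_markov (p : 'rV[C]_d)
    (T T' : Sigma -> 'M[C]_d) (w w' : 'cV[C]_d) (q : {poly C}) :
  q != 0 ->
  (forall t, q.[t] != 0 -> V_hidden_markov R Sigma d n
     (word_value p (fun a => T a + t *: T' a) (w + t *: w'))) ->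
  V_hidden_markov R Sigma d n (word_value p T w).
Proof.
rewrite {2}(closure_id (V_hidden_markov R Sigma d n)).1; last first.
  exact: closed_closure.
exact: closure_affine.
Qed.

(** * Families with diagonal emission factors *)

Lemma nonvanishing_diag_hidden_markov (p : 'rV[C]_d) (D : Sigma -> 'rV[C]_d)
    (N : 'M[C]_d) (w : 'cV[C]_d) :
  \sum_a D a = const_mx 1 -> N *m w = w -> (forall i, w i 0 != 0) ->
  V_hidden_markov R Sigma d n (word_value p (fun a => diag_mx (D a) *m N) w).
Proof.
move=> sumD Nw w_neq0; apply: subset_closure.
(* Conjugation by [S] sends the fixed vector [w] to the vector of ones, and leaves each
   [diag_mx (D a)] alone because diagonal matrices commute. *)
pose S := diag_mx w^T; pose S' : 'M[C]_d := diag_mx (\row_i (w i 0)^-1).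
have SS' : S *m S' = 1%:M.
  rewrite mulmx_diag -diag_const_mx; congr diag_mx.
  by apply/rowP => i; rewrite !mxE divff.
have S1 : S *m ones R d = w.
  by apply/colP => i; rewrite mul_diag_mx !mxE mulr1.
have S'S : S' *m S = 1%:M by exact: mulmx1C.
exists (S' *m N *m S, fun i a => D a 0 i, (p *m S)^T).
  move=> i /=; split.
    have /colP/(_ i) : (S' *m N *m S) *m ones R d = ones R d.
      by rewrite -mulmxA S1 -mulmxA Nw -S1 mulmxA S'S mul1mx.
    rewrite !mxE => <-; apply: eq_bigr => j _.
    by rewrite [ones _ _ _ _]mxE mulr1.
  have /rowP/(_ i) := sumD; by rewrite mxE summxE => <-.
apply/funext => v.
rewrite (@word_value_intertwine _ _ _ S _
  (fun a => diag_mx (D a) *m (S' *m N *m S)) _ _ (ones R d)) //.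
  rewrite /hidden_markov_map /word_fun trmxK /=.
  congr ((_ *m _ *m _) 0 0); apply: eq_bigr => a _; congr (diag_mx _ *m _).
  by apply/rowP => i; rewrite mxE.
move=> a; rewrite [RHS]mulmxA.
have -> : S *m diag_mx (D a) = diag_mx (D a) *m S by exact: diag_mxC.
by rewrite -!mulmxA [S *m (S' *m _)]mulmxA SS' mul1mx.
Qed.

Lemma diag_hidden_markov (p : 'rV[C]_d) (D : Sigma -> 'rV[C]_d)
    (N : 'M[C]_d) (w : 'cV[C]_d) :
  \sum_a D a = const_mx 1 -> N *m w = w -> w != 0 ->
  V_hidden_markov R Sigma d n (word_value p (fun a => diag_mx (D a) *m N) w).
Proof.
move=> sumD Nw /cV0Pn[j wj_neq0].
(* Here [u] is the vector of ones with entry [j] erased, and [y] reads off entry [j] divided by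
   [w j 0]. *)
have [y [yw [u yu u_neq0]]] : exists y : 'rV[C]_d, y *m w = 1%:M /\
    exists2 u : 'cV[C]_d, y *m u = 0 & forall i, i != j -> u i 0 != 0.
  have yE (x : 'cV[C]_d) : ((w j 0)^-1 *: delta_mx 0 j) *m x =
      ((w j 0)^-1 * x j 0)%:M.
    rewrite -scalemxAl -rowE; apply/matrixP => a b.
    by rewrite !ord1 !mxE eqxx mulr1n.
  exists ((w j 0)^-1 *: delta_mx 0 j); split; first by rewrite yE mulVf.
  exists (const_mx 1 - delta_mx j 0) => [|i ij].
    by rewrite yE !mxE !eqxx subrr mulr0 raddf0.
  by rewrite !mxE (negbTE ij) subr0 oner_eq0.
(* The factors are the coordinates of [w + t u]: the [j]-th has constant term [w j 0], the others
   have linear coefficient [u i 0], all nonzero. *)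
pose q : {poly C} := \prod_i ((w i 0)%:P + (u i 0) *: 'X).
have q_neq0 : q != 0.
  apply/prodf_neq0 => i _; apply/eqP => qi0.
  have [eij|/u_neq0/eqP[]] := eqVneq i j.
    move/(congr1 (fun r : {poly C} => r`_0)): qi0.
    by rewrite !coefE /= mulr0 addr0 eij; apply/eqP.
  move/(congr1 (fun r : {poly C} => r`_1)): qi0.
  by rewrite !coefE /= mulr1 add0r.
(* Since y (w + t u) = 1, subtracting the rank-one matrix t (N u - u) y from N
   keeps w + t u a fixed vector. *)
apply: (@closure_affine_hidden_markov p _
  (fun a => diag_mx (D a) *m - ((N *m u - u) *m y)) w u q q_neq0) => t qt.
suff : V_hidden_markov R Sigma d n
    (word_value p (fun a => diag_mx (D a) *m (N - t *: ((N *m u - u) *m y)))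
      (w + t *: u)).
  congr (V_hidden_markov R Sigma d n _); apply/funext => v.
  by apply: eq_word_value => a; rewrite mulmxBr mulmxN scalerN -scalemxAr.
apply: nonvanishing_diag_hidden_markov => //.
  rewrite mulmxBl mulmxDr Nw -!scalemxAr -scalemxAl -mulmxA mulmxDr yw.
  rewrite -scalemxAr yu scaler0 addr0 mulmx1 scalerBr opprB.
  by rewrite -addrA subrKC.
move=> i; move: qt; rewrite horner_prod => /prodf_neq0/(_ i isT).
by rewrite !hornerE !mxE mulrC.
Qed.

(** * Two-letter alphabets *)

Section BinaryAlphabet.
Hypotheses (card_Sigma : #|Sigma| = 2) (d_gt0 : (0 < d)%N).
Variable a0 : Sigma.

(** Serves both for matrices, with [one] the identity, and for rows of diagonal entries, with [one]
    the all-ones row. *)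
Definition binary_split (V : zmodType) (one x : V) (a : Sigma) : V :=
  if a == a0 then x else one - x.

Lemma sum_binary_split (V : zmodType) (one x : V) :
  \sum_a binary_split one x a = one.
Proof.
rewrite (bigD1 a0) //= /binary_split eqxx.
rewrite (eq_bigr (fun=> one - x)) => [|a /negPf -> //].
by rewrite sumr_const cardC1 card_Sigma subrKC.
Qed.

Lemma diagonalizable_hidden_markov (p : 'rV[C]_d) (A M : 'M[C]_d)
    (w : 'cV[C]_d) :
  diagonalizable A -> M *m w = w -> w != 0 ->
  V_hidden_markov R Sigma d n
    (word_value p (fun a => binary_split 1%:M A a *m M) w).
Proof.
move=> [P Pu]; rewrite /similar_to conjumx // => /diag_mxP[D PAP] Mw w_neq0.
have PA : P *m A = diag_mx D *m P by rewrite -PAP mulmxKV.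
suff : V_hidden_markov R Sigma d n (word_value (p *m invmx P)
    (fun a => diag_mx (binary_split (const_mx 1) D a) *m (P *m M *m invmx P))
    (P *m w)).
  congr (V_hidden_markov R Sigma d n _); apply/funext => v.
  apply/esym/word_value_intertwine => [a|]; last by rewrite mulKmx.
  have AD : binary_split 1%:M A a =
      invmx P *m diag_mx (binary_split (const_mx 1) D a) *m P.
    rewrite /binary_split; case: eqP => _.
      by rewrite -mulmxA -PA mulKmx.
    by rewrite raddfB /= diag_const_mx mulmxBr mulmxBl mulmx1 mulVmx // -mulmxA
      -PA mulKmx.
  by rewrite AD !mulmxA.
apply: diag_hidden_markov.
- exact: sum_binary_split.
- by rewrite mulmxA mulmxKV // -mulmxA Mw.
- by apply: contra w_neq0 => /eqP Pw0; rewrite -(mulKmx Pu w) Pw0 mulmx0.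
Qed.

(** The characteristic polynomial has simple roots, and the minimal polynomial divides it. *)
Lemma trig_diagonalizable (L : 'M[C]_d) :
  is_trig_mx L -> injective (fun i => L i i) -> diagonalizable L.
Proof.
move=> Ltrig Linj; case: d d_gt0 L Ltrig Linj => // d' _ L Ltrig Linj.
apply/diagonalizableP; exists [seq L i i | i <- enum 'I_d'.+1].
  by rewrite map_inj_uniq ?enum_uniq.
by rewrite big_map big_enum -char_poly_trig //; exact: mxminpoly_dvd_char.
Qed.

Lemma conj_diagonalizable (P A L : 'M[C]_d) :
  P \in unitmx -> P *m A = L *m P -> diagonalizable L -> diagonalizable A.
Proof.
move=> Pu PA [Q Qu]; rewrite /similar_to (conjumx _ Qu) => Qdiag.
have QPu : Q *m P \in unitmx by rewrite unitmx_mul Qu.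
exists (Q *m P); first exact: QPu.
rewrite /similar_to (conjumx _ QPu).
suff -> : Q *m P *m A *m invmx (Q *m P) = Q *m L *m invmx Q by exact: Qdiag.
apply: (can_inj (mulmxK QPu)).
by rewrite (mulmxKV QPu) mulmxA (mulmxKV Qu) -!mulmxA PA.
Qed.

Lemma binary_hidden_markov (p : 'rV[C]_d) (A M : 'M[C]_d) (w : 'cV[C]_d) :
  M *m w = w -> w != 0 ->
  V_hidden_markov R Sigma d n
    (word_value p (fun a => binary_split 1%:M A a *m M) w).
Proof.
move=> Mw w_neq0.
have [P /unitarymx_unit Pu] := Schur A d_gt0.
rewrite /similar_to conjumx //; set L := _ *m _ *m _ => Ltrig.
(* In a Schur basis the eigenvalues of [A] are the diagonal entries of [L]; adding [t E] shifts the
   [i]-th by [t * i], which separates them unless [q.[t] = 0]. *)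
pose E : 'M[C]_d := diag_mx (\row_i i%:R).
pose q : {poly C} := \prod_(ij : 'I_d * 'I_d | ij.1 != ij.2)
  ((L ij.1 ij.1 - L ij.2 ij.2)%:P + (ij.1%:R - ij.2%:R) *: 'X).
have q_neq0 : q != 0.
  apply/prodf_neq0 => -[i j] /= ij; apply: contra ij => /eqP.
  move/(congr1 (fun r : {poly C} => r`_1)) => /eqP.
  by rewrite !coefE /= mulr1 add0r subr_eq0 eqr_nat.
pose B := invmx P *m E *m P.
(* Opposite signs on the two letters keep the sum equal to [M]. *)
pose T' a := (if a == a0 then B else - B) *m M.
apply: (@closure_affine_hidden_markov p _ T' w 0 q q_neq0) => t qt.
suff : V_hidden_markov R Sigma d n
    (word_value p (fun a => binary_split 1%:M (A + t *: B) a *m M) w).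
  congr (V_hidden_markov R Sigma d n _); apply/funext => v.
  rewrite scaler0 addr0; apply: eq_word_value => a.
  rewrite /T' /binary_split [t *: (_ *m M)]scalemxAl -mulmxDl.
  case: eqP => // _.
  by rewrite scalerN opprD addrA.
apply: diagonalizable_hidden_markov => //.
apply: (conj_diagonalizable (L := L + t *: E) Pu).
  rewrite mulmxDr mulmxDl -scalemxAr -scalemxAl (mulmxKV Pu) !mulmxA.
  by rewrite (mulmxV Pu) mul1mx.
apply: trig_diagonalizable.
- apply/is_trig_mxP => i j ij; move/is_trig_mxP: Ltrig => Ltrig.
  by rewrite mxE Ltrig // !mxE -val_eqE ltn_eqF // mulr0n mulr0 addr0.
move=> i j Lij; apply/eqP; apply: contraNT qt => ij.
rewrite horner_prod (bigD1 (i, j)) //= hornerD hornerC hornerZ hornerX.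
rewrite mulrBl addrACA -opprD mulf_eq0 subr_eq0 [_ * t]mulrC [_ * t]mulrC.
by move: Lij; rewrite !mxE !eqxx !mulr1n => ->; rewrite eqxx.
Qed.
End BinaryAlphabet.

(** * The two inclusions *)

Lemma hidden_markov_sub_finitary :
  hidden_markov_map n @` hidden_markov_model R Sigma d `<=`
  finitary_map n @` finitary_model R Sigma d.
Proof.
move=> _ [[[M E] p] HM <-].
exists (fun a => emission_mx E a *m M, p) => //=.
have M1 : M *m ones R d = ones R d.
  apply/colP => i; have [Mi _] := HM i; rewrite !mxE -[RHS]Mi.
  by apply: eq_bigr => j _; rewrite mxE mulr1.
rewrite /finitary_model /= -mulmx_suml -mulmxA M1.
apply/colP => i; have [_ Ei] := HM i.
rewrite mulmx_suml summxE !mxE -[RHS]Ei.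
by apply: eq_bigr => a _; rewrite mul_diag_mx !mxE mulr1.
Qed.

Lemma finitary_sub_V_hidden_markov :
  #|Sigma| = 2 -> (0 < d)%N ->
  finitary_map n @` finitary_model R Sigma d `<=` V_hidden_markov R Sigma d n.
Proof.
move=> card_Sigma d_gt0 _ [[T p] /= sumT <-].
have [a0 _] : exists a0, a0 \in Sigma by apply/card_gt0P; rewrite card_Sigma.
rewrite /finitary_model /= in sumT; set M := \sum_a T a in sumT.
(* Only the other letter moves, so the sum runs along the line from [M] to the identity. It fixes
   the vector of ones throughout and is invertible at [t = 1], hence [q] is not zero. *)
pose T' a := if a == a0 then 0 else 1%:M - M.
pose q := \det (affine_mx M (1%:M - M)).
have qE t : q.[t] = \det (M + t *: (1%:M - M)).
  by rewrite -horner_affine_mx det_map_mx.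
have q_neq0 : q != 0.
  apply/eqP => q0; have := qE 1.
  by rewrite q0 horner0 scale1r subrKC det1 => /esym/eqP; rewrite oner_eq0.
apply: (@closure_affine_hidden_markov p^T T T' (ones R d) 0 q q_neq0) => t qt.
pose Mt := M + t *: (1%:M - M).
have Mtu : Mt \in unitmx by rewrite unitmxE unitfE -qE.
suff : V_hidden_markov R Sigma d n (word_value p^T
    (fun a => binary_split a0 1%:M (T a0 *m invmx Mt) a *m Mt) (ones R d)).
  congr (V_hidden_markov R Sigma d n _); apply/funext => v.
  rewrite scaler0 addr0; apply: eq_word_value => a.
  rewrite /T' /binary_split; case: eqP => [->|/eqP a_neq0].
    by rewrite (mulmxKV Mtu) scaler0 addr0.
  rewrite mulmxBl mul1mx (mulmxKV Mtu) /Mt addrAC; congr (_ + _).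
  (* A letter [b] other than [a0] and [a] would be a third one; hence [M - T a0 = T a]. *)
  have aE b : (b != a0) = (b == a).
    have [->|ba] := eqVneq b a; first by rewrite a_neq0.
    apply/negbTE/negP => ba0; have := max_card (mem [:: a0; a; b]).
    rewrite card_Sigma (card_uniqP _) //= !inE negb_or.
    by rewrite ![a0 == _]eq_sym a_neq0 ba0 eq_sym ba.
  by rewrite /M (bigD1 a0) //= (eq_bigl _ _ aE) big_pred1_eq addrC addKr.
apply: binary_hidden_markov => //.
  by rewrite mulmxDl sumT -scalemxAl mulmxBl mul1mx sumT subrr scaler0 addr0.
by apply/cV0Pn; exists (Ordinal d_gt0); rewrite mxE oner_eq0.
Qed.
End Closure.

Theorem corollary5p7 (R : realType) (Sigma : finType) (d n : nat)
    (d_gt0 : (0 < d)%N) (n_gt0 : (0 < n)%N) (card_Sigma : #|Sigma| = 2) :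
  V_hidden_markov R Sigma d n = V_finitary R Sigma d n.
Proof.
apply/seteqP; split.
  by apply: closureS; exact: hidden_markov_sub_finitary.
rewrite [X in _ `<=` X](closure_id _).1; last exact: closed_closure.
by apply: closureS; exact: finitary_sub_V_hidden_markov.
Qed.
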